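(* Let $T$ be a linear relation from a Hilbert space $\mathfrak H$ to a Hilbert space $\mathfrak K$. Then $T$ admits the operator-like sum decomposition $$T=T_{\rm reg}+T_{\rm sing},$$ where $T_{\rm reg}$ is a regular relation from $\mathfrak H$ to $\mathfrak K$ and $T_{\rm sing}$ is a singular relation from $\mathfrak H$ to $\mathfrak K$ with $$\operatorname{mul} T_{\rm sing}=\operatorname{mul} T,\qquad \operatorname{mul}\,\overline{T_{\rm sing}}=\operatorname{mul}\overline T .$$
   Context: Hilbert spaces are complex. A linear relation $T$ from $\mathfrak H$ to $\mathfrak K$ is a (not necessarily closed) linear subspace of the Hilbert space $\mathfrak H\times\mathfrak K$, with elements written $\{f,f'\}$; $\overline T$ is its closure in $\mathfrak H\times\mathfrak K$. An operator is identified with its graph. Notation: $\operatorname{mul}T=\{f'\in\mathfrak K:\{0,f'\}\in T\}$ and $\operatorname{ran}T=\{f':\{f,f'\}\in T\}$. The operator-like sum of relations $A,B$ from $\mathfrak H$ to $\mathfrak K$ is $A+B=\{\{f,f'+f''\}:\{f,f'\}\in A,\ \{f,f''\}\in B\}$. $T$ is regular if $\overline T$ is (the graph of) an operator, i.e. $\operatorname{mul}\overline T=\{0\}$. $T$ is singular if $\operatorname{ran}T\subset\operatorname{mul}\overline T$. Let $P$ be the orthogonal projection from $\mathfrak K$ onto the closed subspace $\operatorname{mul}\overline T$. Then $T_{\rm reg}=\{\{f,(I-P)f'\}:\{f,f'\}\in T\}$ and $T_{\rm sing}=\{\{f,Pf'\}:\{f,f'\}\in T\}$. *)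

(* Defs.v *)
From HB Require Import structures.
From mathcomp Require Export all_boot all_order all_algebra.
From mathcomp Require Export complex.
From mathcomp Require Export all_classical all_reals all_analysis.
Export numFieldNormedType.Exports.

Set Implicit Arguments.
Unset Strict Implicit.
Unset Printing Implicit Defensive.

Import GRing.Theory Num.Theory.

Local Open Scope classical_set_scope.
Local Open Scope complex_scope.
Local Open Scope ring_scope.

(* A complex Hilbert space: a Banach space over R[i] whose norm comes from
   an inner product, linear in its first argument. *)
HB.mixin Record isHilbert (R : realType) H of CompleteNormedModule R[i] H := {
  inner : {dot H for (@Num.conj R[i])} ;
  normsq_inner : forall x : H, `|x| ^+ 2 = inner x x
}.

#[short(type="hilbertType")]
HB.structure Definition Hilbert (R : realType) :=
  {H of isHilbert R H & CompleteNormedModule R[i] H}.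

Section LinearRelations.
Context {R : realType} {H K : hilbertType R}.
Implicit Types (T A B : set (H * K)) (M : set K).

Definition linear_relation T := GRing.submod_closed [in T].

Definition mul T : set K := [set f' | T (0, f')].

Definition ran T : set K := [set f' | exists f, T (f, f')].

Definition opsum A B : set (H * K) :=
  [set p | exists f' f'', [/\ A (p.1, f'), B (p.1, f'') & p.2 = f' + f'']].

(* The product topology on H * K is that of the Hilbert space product, although
   the norm of the library on H * K is the maximum of the two norms. *)
Definition regular T := mul (closure T) = [set 0].

Definition singular T := ran T `<=` mul (closure T).

(* The point of M such that x - y is orthogonal to M; such a y exists and is
   unique when M is a closed subspace, and 0 is a junk value otherwise. *)
Definition orthproj M (x : K) : K :=
  xget 0 [set y | M y /\ forall z, M z -> inner (x - y) z = 0].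

Definition reg_part T : set (H * K) :=
  [set (p.1, p.2 - orthproj (mul (closure T)) p.2) | p in T].

Definition sing_part T : set (H * K) :=
  [set (p.1, orthproj (mul (closure T)) p.2) | p in T].

End LinearRelations.

(* Main.v *)
(* With M = mul (closure T) and P the orthogonal projection onto M, the vectors
   (0, Pg) lie in closure T, so T_reg lies in closure T; hence mul of its closure
   lies in M, and also in ker P since P vanishes on ran T_reg: it is 0. For
   T_sing, the continuous map (f, g) |-> (f, Pg) sends closure T into
   closure T_sing and fixes (0, g) for g in M, while ran T_sing lies in the
   closed set M. The projection exists because, by the parallelogram law, the
   near-minimizers of the distance to M form a Cauchy filter. *)
Require Import Defs.
From mathcomp Require Import ring.
Import Order.TTheory GRing.Theory Num.Theory.

Local Open Scope classical_set_scope.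
Local Open Scope complex_scope.
Local Open Scope ring_scope.

(** * Linear subspaces, their images and their closures *)

Lemma submod_set_closedP (F : pzRingType) (V : lmodType F) (A : set V) :
  GRing.submod_closed [in A] <->
  A 0 /\ forall a u v, A u -> A v -> A (a *: u + v).
Proof.
split=> -[A0 AP]; split; rewrite ?inE //.
- by move: A0; rewrite inE.
- by move=> a u v Au Av; have := AP a u v; rewrite !inE; apply.
- by move=> a u v; rewrite !inE; exact: AP.
Qed.

Lemma image_submod (F : pzRingType) (V W : lmodType F) (f : V -> W)
    (A : set V) :
  linear f -> GRing.submod_closed [in A] -> GRing.submod_closed [in f @` A].
Proof.
move=> fl /submod_set_closedP[A0 AP]; apply/submod_set_closedP; split.
  (* Scalar -1 at the vectors 0 and 0 gives [f 0 = - f 0 + f 0], which is 0. *)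
  exists 0 => //; have := fl (-1) 0 0.
  by rewrite !scaleN1r oppr0 addr0 addNr.
move=> a _ _ [u Au <-] [v Av <-].
by exists (a *: u + v); [exact: AP | exact: fl].
Qed.

(** All limit arguments about the two parts of [T] go through this transfer. A superset [B] stands
    in for the image so that it applies with [B] the zero set, [M] or [sing_part T]. *)
Lemma closure_image_sub (X Y : topologicalType) (f : X -> Y) (A : set X)
    (B : set Y) :
  continuous f -> f @` A `<=` B -> closure A `<=` f @^-1` closure B.
Proof.
move=> fc fAB x xA U /(fc x) /xA[y [Ay Uy]].
by exists (f y); split=> //; apply: fAB; exists y.
Qed.

(** By joint continuity of [(u, v) |-> a *: u + v], a neighbourhood of the value pulls back to a
    product of neighbourhoods of [u] and [v], each of which meets [A]. *)
Lemma closure_submod (F : numFieldType) (V : normedModType F) (A : set V) :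
  GRing.submod_closed [in A] -> GRing.submod_closed [in closure A].
Proof.
move=> /submod_set_closedP[A0 AP]; apply/submod_set_closedP.
split; first exact: subset_closure.
move=> a u v uA vA U nU.
have : (fun p : V * V => a *: p.1 + p.2) p @[p --> (u, v)] --> a *: u + v.
  by apply: cvgD; [apply: cvgZr; exact: cvg_fst | exact: cvg_snd].
move=> /(_ U nU)[[U1 U2] /= [/uA[u' [Au' Uu']] /vA[v' [Av' Uv']]] UU].
exists (a *: u' + v'); split; first exact: AP.
exact: (UU (u', v')).
Qed.

(** * Inner product identities and nearest points *)

Section HilbertGeometry.
Context {R : realType} {K : hilbertType R}.
Implicit Types (M : set K) (x y z u v w : K).

Lemma inner_conj u v : inner u v = (inner v u)^*%R.
Proof. by rewrite hermC expr0 mul1r. Qed.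

Lemma normsqD u v :
  `|u + v| ^+ 2 = `|u| ^+ 2 + `|v| ^+ 2 + (inner u v + inner v u).
Proof.
rewrite !normsq_inner linearDl /= !linearDr /=; ring.
Qed.

Lemma normsqB u v :
  `|u - v| ^+ 2 = `|u| ^+ 2 + `|v| ^+ 2 - (inner u v + inner v u).
Proof. by rewrite normsqD normrN linearNl linearNr /= opprD. Qed.

Lemma parallelogram u v :
  `|u + v| ^+ 2 + `|u - v| ^+ 2 = 2 * `|u| ^+ 2 + 2 * `|v| ^+ 2.
Proof. by rewrite normsqD normsqB; ring. Qed.

Lemma pythagoras u v : inner u v = 0 -> `|u + v| ^+ 2 = `|u| ^+ 2 + `|v| ^+ 2.
Proof. by move=> uv0; rewrite normsqD (inner_conj v) uv0 conjC0 !addr0. Qed.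

(** For [w] nonzero, the best choice [t = inner y w / |w|^2] lowers [|y|^2] by
    [|inner y w|^2 / |w|^2], so minimality forces this amount to vanish. *)
Lemma inner_eq0_of_min y w :
  (forall t : R[i], `|y| ^+ 2 <= `|y - t *: w| ^+ 2) -> inner y w = 0.
Proof.
move=> ymin; have [->|w0] := eqVneq w 0; first by rewrite linear0r.
set c := inner y w; have w2 : 0 < `|w| ^+ 2 by rewrite exprn_gt0 ?normr_gt0.
have := ymin (c / `|w| ^+ 2).
have tc : (c / `|w| ^+ 2)^*%R = c^*%R / `|w| ^+ 2.
  by rewrite rmorphM /= fmorphV /= (@conj_Creal _ (`|w| ^+ 2)) // gtr0_real.
rewrite normsqB normrZ linearZl_LR linearZr_LR /= -/c (inner_conj w) -/c tc.
rewrite exprMn normrM exprMn normfV (ger0_norm (ltW w2)) normCK.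
rewrite -subr_ge0.
have -> : `|y| ^+ 2 + c * c^*%R * (`|w| ^+ 2)^-1 ^+ 2 * `|w| ^+ 2
    - (c^*%R / `|w| ^+ 2 * c + c / `|w| ^+ 2 * c^*%R) - `|y| ^+ 2
    = - (c * c^*%R / `|w| ^+ 2) by field; rewrite normr_eq0.
rewrite -normCK oppr_ge0 pmulr_lle0 ?invr_gt0 // => c2.
by apply/eqP; rewrite -normr_eq0 -sqrf_eq0 eq_le c2 exprn_ge0.
Qed.

(** The order of [R[i]] is partial; reality turns the failure of [a <= b] into [b < a], and then
    [e = a - b] gives [a < a]. *)
Lemma le_realC_eps (a b : R[i]) : a \is Num.real -> b \is Num.real ->
  (forall e, 0 < e -> a < b + e) -> a <= b.
Proof.
move=> ar br ab; rewrite real_leNgt //; apply/negP => ba.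
by have := ab (a - b); rewrite subr_gt0 addrC subrK ltxx => /(_ ba).
Qed.

(** Norms take values in [R[i]], so the infimum is formed in [R] from the real parts of the squared
    distances and embedded back. *)
Lemma dist_infimum M x : M !=set0 -> exists2 D : R[i], D \is Num.real &
  (forall z, M z -> D <= `|x - z| ^+ 2) /\
  (forall e, 0 < e -> exists2 z, M z & `|x - z| ^+ 2 < D + e).
Proof.
move=> [z0 Mz0].
pose S := [set complex.Re (`|x - z| ^+ 2 : R[i]) | z in M].
have ReK z : (complex.Re (`|x - z| ^+ 2 : R[i]))%:C = `|x - z| ^+ 2 :> R[i].
  by rewrite RRe_real // ger0_real // exprn_ge0.
have Sinf : has_inf S.
  split; first by exists (complex.Re (`|x - z0| ^+ 2 : R[i])); exists z0.
  by exists 0 => _ [z _ <-]; rewrite -lecR ReK exprn_ge0.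
exists (inf S)%:C; first by apply/complex_realP; exists (inf S).
split=> [z Mz|e e0].
  by rewrite -ReK lecR; apply: ge_inf; [case: Sinf | exists z].
have eK : (complex.Re e)%:C = e by rewrite RRe_real // gtr0_real.
have e0' : 0 < complex.Re e by rewrite -ltcR eK.
have [_ [z Mz <-] zlt] := inf_adherent e0' Sinf.
by exists z => //; rewrite -ReK -eK -rmorphD /= ltcR.
Qed.

Lemma nearest_point M x : closed M -> GRing.submod_closed [in M] ->
  exists2 z, M z & forall w, M w -> `|x - z| ^+ 2 <= `|x - w| ^+ 2.
Proof.
move=> Mcl /submod_set_closedP[M0 MP].
have [D Dr [Dle Dlt]] := @dist_infimum M x (ex_intro _ 0 M0).
pose B (e : R[i]) := [set z | M z /\ `|x - z| ^+ 2 < D + e].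
pose F := filter_from [set e : R[i] | 0 < e] B.
have FF : ProperFilter F.
  apply: filter_from_proper; last first.
    by move=> e /= /Dlt[z Mz zlt]; exists z.
  apply: filter_from_filter; first by exists 1 => /=.
  move=> e1 e2 /= e1_gt0 e2_gt0.
  (* Positive elements of [R[i]] are real, hence comparable, so their minimum behaves as in a total
     order. *)
  have e12 : e1 >=< e2 by rewrite real_comparable // gtr0_real.
  exists (Order.min e1 e2) => /=; first by rewrite comparable_lt_min ?e1_gt0.
  move=> z [Mz zlt]; split; split=> //.
    by apply: (lt_le_trans zlt); rewrite lerD2l comparable_ge_min // lexx.
  by apply: (lt_le_trans zlt); rewrite lerD2l comparable_ge_min // lexx orbT.
(* The midpoint of [z] and [w] lies in [M], so its squared distance to [x] is at least [D]; the
   parallelogram law for [x - z] and [x - w] then leaves less than [4(D + e) - 4D = 4e]. *)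
have Bdist e z w : B e z -> B e w -> `|z - w| ^+ 2 < 4 * e.
  move=> [Mz zlt] [Mw wlt].
  have mid : M (2^-1 *: (z + w)).
    have := MP 2^-1 (z + w) 0; rewrite addr0; apply=> //.
    by have := MP 1 z w; rewrite scale1r; apply.
  have := parallelogram (x - z) (x - w).
  have -> : x - z + (x - w) = 2 *: (x - 2^-1 *: (z + w)).
    rewrite scalerBr scalerA divff ?pnatr_eq0 // scale1r.
    by rewrite scaler_nat mulr2n opprD addrACA.
  have -> : x - z - (x - w) = - (z - w).
    by rewrite opprB addrC addrA subrK opprB.
  rewrite normrN normrZ exprMn => par.
  have -> : `|z - w| ^+ 2 = 2 * `|x - z| ^+ 2 + 2 * `|x - w| ^+ 2
      - 4 * `|x - 2^-1 *: (z + w)| ^+ 2.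
    by rewrite -par ger0_norm //; ring.
  have -> : 4 * e = 2 * (D + e) + 2 * (D + e) - 4 * D by ring.
  rewrite ltr_leB ?ler_pM2l ?Dle //.
  by rewrite ltrD // ltr_pM2l.
have Fc : cauchy F.
  apply: cauchy_exP => e e0.
  (* The radius [e ^+ 2 / 4] makes the bound [4e] of [Bdist] equal to [e ^+ 2]. *)
  have e20 : 0 < e ^+ 2 / 4 by rewrite divr_gt0 ?exprn_gt0.
  have [z Mz zlt] := Dlt _ e20; exists z; exists (e ^+ 2 / 4) => //= w Bw.
  rewrite -ball_normE /= -(@ltr_pXn2r _ 2) ?nnegrE ?(ltW e0) //.
  have := @Bdist (e ^+ 2 / 4) z w (conj Mz zlt) Bw.
  by rewrite mulrCA divff ?mulr1 ?pnatr_eq0.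
have [z Fz] : exists z, F --> z.
  by exists (lim F); exact: (cauchy_cvg F Fc).
exists z.
  apply: (@closed_cvg _ _ F _ id M Mcl _ z Fz).
  by exists 1 => //= w [Mw _].
move=> w /Dle; apply: le_trans.
(* It remains to bound [|x - z|^2] by [D]: some [u] in [B (e / 2)] has [|x - u|^2] within [e / 2] of
   [|x - z|^2], and the two halves add up to [e]. *)
apply: le_realC_eps => // e e0.
have e2 : 0 < e / 2 by rewrite divr_gt0.
have xu : x - u @[u --> F] --> x - z by apply: cvgB; [exact: cvg_cst | exact: Fz].
have Fe : \forall u \near F, `| `|x - z| ^+ 2 - `|x - u| ^+ 2| < e / 2.
  have nx : Num.norm (x - u) @[u --> F] --> Num.norm (x - z) by exact: cvg_norm.
  exact: ((cvgrPdist_lt _ _).1 (cvgM nx nx) _ e2).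
have FB : F (B (e / 2)) by exists (e / 2).
have [u [/= ulim [_ ult]]] := filter_ex (filterI Fe FB).
have -> : D + e = e / 2 + (D + e / 2) by field.
rewrite -[X in X < _](subrK (`|x - u| ^+ 2)).
apply: ltrD => //; apply: le_lt_trans ulim; apply: real_ler_norm.
by rewrite rpredB // ger0_real // exprn_ge0.
Qed.

(** * Orthogonal projection onto a closed subspace *)

Section Projection.
Context (M : set K) (Mcl : closed M) (Msub : GRing.submod_closed [in M]).
Local Notation P := (orthproj M).

Let M0 : M 0. Proof. by have /submod_set_closedP[] := Msub. Qed.
Let MP a u v : M u -> M v -> M (a *: u + v).
Proof. by have /submod_set_closedP[_] := Msub; apply. Qed.

(** The junk value is excluded because the nearest point [z] qualifies: [t *: w + z] stays in [M],
    so minimality makes [x - z] orthogonal to every [w] in [M]. *)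
Lemma orthprojP x : M (P x) /\ forall z, M z -> inner (x - P x) z = 0.
Proof.
rewrite /orthproj; case: xgetP => [y _ //|none].
have [z Mz zmin] := nearest_point M x Mcl Msub; case: (none z); split=> // w Mw.
apply: inner_eq0_of_min => t.
have -> : x - z - t *: w = x - (t *: w + z) by rewrite opprD addrA addrAC.
by apply: zmin; exact: MP.
Qed.

(** The vector [P x - y] lies in [M] and is also a difference of two vectors orthogonal to [M], so
    it is orthogonal to itself. *)
Lemma orthproj_uniq x y :
  M y -> (forall z, M z -> inner (x - y) z = 0) -> P x = y.
Proof.
move=> My yperp; have [MPx Pperp] := orthprojP x.
apply/eqP; rewrite -subr_eq0 -normr_eq0 -sqrf_eq0 normsq_inner.
have Md : M (P x - y) by rewrite addrC -scaleN1r; exact: MP.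
have dE : P x - y = x - y - (x - P x) by rewrite opprB [RHS]addrC subrKA.
by rewrite {1}dE linearBl /= yperp // Pperp // subrr.
Qed.

Lemma orthproj_id x : M x -> P x = x.
Proof. by move=> Mx; apply: orthproj_uniq => // z _; rewrite subrr linear0l. Qed.

Lemma orthproj_linear a x y : P (a *: x + y) = a *: P x + P y.
Proof.
have [MPx xperp] := orthprojP x; have [MPy yperp] := orthprojP y.
apply: orthproj_uniq => [|z Mz]; first exact: MP.
rewrite opprD addrACA -scalerBr linearDl linearZl_LR /=.
by rewrite xperp // yperp // mulr0 addr0.
Qed.

Lemma orthprojB x y : P (x - y) = P x - P y.
Proof. by rewrite addrC -scaleN1r orthproj_linear scaleN1r addrC. Qed.

Lemma orthproj_contraction x : `|P x| <= `|x|.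
Proof.
have [MPx xperp] := orthprojP x.
rewrite -(@ler_pXn2r _ 2) ?nnegrE // -[x in leRHS](subrK (P x)).
by rewrite pythagoras ?xperp // lerDr exprn_ge0.
Qed.

Lemma orthproj_continuous : continuous P.
Proof.
move=> x; apply/cvgrPdist_lt => e e0; near=> y.
rewrite -orthprojB; apply: le_lt_trans (orthproj_contraction _) _.
by near: y; apply: cvgr_dist_lt.
Unshelve. all: by end_near. Qed.

End Projection.
End HilbertGeometry.

(** * The regular and singular parts of a linear relation *)

Section LinearRelationParts.
Context {R : realType} {H K : hilbertType R}.
Context (T : set (H * K)) (hT : linear_relation T).
Local Notation M := (mul (closure T)).
Local Notation P := (orthproj M).

Let TP a p q : T p -> T q -> T (a *: p + q).
Proof. by have /submod_set_closedP[_] := hT; apply. Qed.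

Lemma closure_linear_relation : linear_relation (closure T).
Proof. exact: closure_submod. Qed.

Lemma mul_closure_submod : GRing.submod_closed [in M].
Proof.
have /submod_set_closedP[cT0 cTP] := closure_linear_relation.
apply/submod_set_closedP; split=> // a u v Mu Mv; rewrite /mul /=.
have -> : (0, a *: u + v) = a *: (0, u) + (0, v) :> H * K.
  by congr pair => /=; rewrite scaler0 addr0.
exact: cTP.
Qed.

Lemma mul_closure_closed : closed M.
Proof.
rewrite (_ : M = (fun y : K => (0 : H, y)) @^-1` closure T) //.
apply: closed_comp; last exact: closed_closure.
by move=> y _; apply: cvg_pair; [exact: cvg_cst | exact: cvg_id].
Qed.

Let Mcl := mul_closure_closed.
Let Msub := mul_closure_submod.

Lemma mul_sub_mul_closure : mul T `<=` M.
Proof. by move=> y Ty; rewrite /mul /=; apply: subset_closure. Qed.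

(** In the inclusion from right to left, the summands may come from different pairs [(f, g1)] and
    [(f, g2)] of [T]. Their difference puts [g1 - g2] in [mul T], hence in [M], where [P] is the
    identity; so [g1 - P g1 + P g2] is [g2]. *)
Lemma opsum_reg_sing : T = opsum (reg_part T) (sing_part T).
Proof.
apply/seteqP; split=> [[f g] Tfg|[f g]].
  exists (g - P g), (P g); split=> /=; [by exists (f, g)|by exists (f, g)|].
  by rewrite subrK.
move=> [_ [_ [/= [[f1 g1] Tfg1 [/= f1E <-]] [[f2 g2] Tfg2 [/= f2E <-]] ->]]].
rewrite {f1}f1E in Tfg1; rewrite {f2}f2E in Tfg2.
have Mg : M (g1 - g2).
  apply: mul_sub_mul_closure; rewrite /mul /=.
  have -> : (0, g1 - g2) = -1 *: (f, g2) + (f, g1) :> H * K.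
    by congr pair => /=; rewrite scaleN1r addrC ?subrr.
  exact: TP.
have := orthproj_id M Mcl Msub _ Mg; rewrite orthprojB // => PB.
by have -> : g1 - P g1 + P g2 = g2 by rewrite -addrA (addrC (- P g1)) -opprB PB subKr.
Qed.

Lemma reg_part_sub_closure : reg_part T `<=` closure T.
Proof.
move=> _ [[f g] Tfg <-] /=.
have /submod_set_closedP[_ cTP] := closure_linear_relation.
have -> : (f, g - P g) = -1 *: (0, P g) + (f, g) :> H * K.
  by congr pair => /=; rewrite ?scaler0 ?add0r // scaleN1r addrC.
by apply: cTP; [have [] := orthprojP M Mcl Msub g | exact: subset_closure].
Qed.

Let MP x : M (P x). Proof. by have [] := orthprojP M Mcl Msub x. Qed.

Lemma linear_reg_part : linear_relation (reg_part T).
Proof.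
apply: image_submod => // a [f g] [f' g'] /=; congr pair => /=.
by rewrite orthproj_linear // scalerBr addrACA opprD.
Qed.

Lemma linear_sing_part : linear_relation (sing_part T).
Proof.
apply: image_submod => // a [f g] [f' g'] /=; congr pair => /=.
exact: orthproj_linear.
Qed.

Lemma regular_reg_part : regular (reg_part T).
Proof.
apply/seteqP; split=> [g cg|_ ->] /=; last first.
  rewrite /mul /=; apply: subset_closure.
  by have /submod_set_closedP[] := linear_reg_part.
have Mg : M g.
  have := closureS reg_part_sub_closure cg.
  by rewrite -((closure_id (closure T)).1 (@closed_closure _ T)).
(* As [g = P g], it suffices that [P g = 0]: the continuous map [(f, g) |-> P g] vanishes on
   [reg_part T], hence on its closure, the zero set being closed. *)
rewrite -(orthproj_id M Mcl Msub _ Mg).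
have Psnd : continuous (fun p : H * K => P p.2).
  move=> p; apply: (@continuous_comp _ _ _ snd P); first exact: cvg_snd.
  exact: orthproj_continuous.
have reg_ker : (fun p => P p.2) @` reg_part T `<=` [set 0].
  move=> _ [_ [p _ <-] <-] /=.
  by rewrite orthprojB // (orthproj_id M Mcl Msub (P _)) // subrr.
have := closure_image_sub _ _ _ _ _ Psnd reg_ker _ cg.
rewrite -((closure_id [set 0]).1 _) //.
exact/accessible_closed_set1/hausdorff_accessible/norm_hausdorff.
Qed.

Lemma mul_closure_sing_part : mul (closure (sing_part T)) = M.
Proof.
apply/seteqP; split=> g.
  move=> cg; rewrite [M](closure_id _).1 //.
  apply: (closure_image_sub _ _ snd _ _ _ _ (0, g) cg).
    by move=> p; exact: cvg_snd.
  by move=> _ [_ [p _ <-] <-] /=; exact: MP.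
(* Writing [g] as [P g] makes [(0, g)] its own image under [(f, g) |-> (f, P g)], a map that takes
   [T] onto [sing_part T]. *)
move=> Mg; rewrite /mul /= -(orthproj_id M Mcl Msub _ Mg).
apply: (closure_image_sub _ _ (fun p => (p.1, P p.2)) _ _ _ _ (0, g) Mg) => //.
move=> p; apply: cvg_pair; first exact: cvg_fst.
apply: (@continuous_comp _ _ _ snd P); first exact: cvg_snd.
exact: orthproj_continuous.
Qed.

Lemma singular_sing_part : singular (sing_part T).
Proof.
by rewrite /singular mul_closure_sing_part => _ [f [p _ [_ <-]]]; exact: MP.
Qed.

(** The projection keeps first coordinates, and a pair [(0, g)] of [T] has [g] in [M], so it is left
    unchanged. *)
Lemma mul_sing_part : mul (sing_part T) = mul T.
Proof.
apply/seteqP; split=> [_ [[f g] Tfg [/= f0 <-]]|g Tg].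
  rewrite f0 in Tfg.
  by rewrite /= (orthproj_id M Mcl Msub) //; exact: mul_sub_mul_closure.
exists (0, g) => //=; rewrite (orthproj_id M Mcl Msub) //.
exact: mul_sub_mul_closure.
Qed.
End LinearRelationParts.

Theorem theorem4p1 (R : realType) (H K : hilbertType R) (T : set (H * K)%type)
    (hT : linear_relation T) :
  [/\ T = opsum (reg_part T) (sing_part T),
      linear_relation (reg_part T) /\ regular (reg_part T),
      linear_relation (sing_part T) /\ singular (sing_part T),
      mul (sing_part T) = mul T
    & mul (closure (sing_part T)) = mul (closure T)].
Proof.
split; [exact: opsum_reg_sing | split | split | exact: mul_sing_part
  | exact: mul_closure_sing_part].
- exact: linear_reg_part.
- exact: regular_reg_part.
- exact: linear_sing_part.
- exact: singular_sing_part.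
Qed.
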